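(* Let $m\ge 1$ and $1\le i\le m$. For all sufficiently large positive integers $q$, the number of points $(x_1,\dots,x_m)\in\mathbb{Z}_q^m$ with $x_i=0$ that lie on no hyperplane $H'_q$ with $H'\in\mathcal{B}_m\setminus\{\{x_i=0\}\}$ equals $$(q-2m+1)^{m-i}(q-2m+2)^{i-1}.$$ In other words, the characteristic quasi-polynomial of the restriction $\mathcal{B}_m^{\{x_i=0\}}$ is $|M((\mathcal{B}_m^{\{x_i=0\}})_q)|=(q-2m+1)^{m-i}(q-2m+2)^{i-1}$.
   Context: For $m\ge1$, the Shi arrangement of type B is the set of affine hyperplanes in $\mathbb{R}^m$ $$\mathcal{B}_m=\{\{x_s=0\},\{x_s=1\}\mid s\in[m]\}\cup\{\{x_s\pm x_t=0\},\{x_s\pm x_t=1\}\mid 1\le s<t\le m\},$$ where $[m]=\{1,\dots,m\}$. For a positive integer $q$ and a hyperplane $H=\{a_1x_1+\dots+a_mx_m=b\}$ with integer coefficients, $H_q=\{x\in\mathbb{Z}_q^m : [a_1]_qx_1+\dots+[a_m]_qx_m=[b]_q\}$ is its reduction modulo $q$, with $\mathbb{Z}_q=\mathbb{Z}/q\mathbb{Z}$. For $H\in\mathcal{B}_m$, the restriction is $\mathcal{B}_m^H=\{H\cap H' : H'\in\mathcal{B}_m\setminus\{H\},\ H\cap H'\neq\emptyset\}$, and $|M((\mathcal{B}_m^H)_q)|$ denotes the number of points of $H_q$ not lying on any $H'_q$ with $H'\in\mathcal{B}_m\setminus\{H\}$; this is a quasi-polynomial in $q$ (the characteristic quasi-polynomial).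 *)

(* Defs.v *)
From mathcomp Require Import all_boot all_order all_algebra.

Set Implicit Arguments.
Unset Strict Implicit.
Unset Printing Implicit Defensive.

Import GRing.Theory.
Local Open Scope ring_scope.

(* The equation a_1 x_1 + ... + a_m x_m = b, stored as the pair (a, b).
   An arrangement is a list of such equations; this is the same as a set of
   hyperplanes as long as no two of its equations are proportional. *)
Notation int_hyperplane m := ('rV[int]_m * int)%type.

(* 'Z_q is Z/qZ only when 1 < q. *)
Definition hyperplane_mod (q m : nat) (H : int_hyperplane m) :
    {set 'rV['Z_q]_m} :=
  [set x : 'rV['Z_q]_m | \sum_(j < m) (H.1 0 j)%:~R * x 0 j == H.2%:~R].

Definition coord_hyp (m : nat) (s : 'I_m) (b : int) : int_hyperplane m :=
  (delta_mx 0 s, b).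

Definition sum_hyp (m : nat) (s t : 'I_m) (b : int) : int_hyperplane m :=
  (delta_mx 0 s + delta_mx 0 t, b).

Definition diff_hyp (m : nat) (s t : 'I_m) (b : int) : int_hyperplane m :=
  (delta_mx 0 s - delta_mx 0 t, b).

(* The equations below have primitive coefficient vectors with leading
   coefficient 1 and are pairwise distinct, hence pairwise non-proportional. *)
Definition shiB (m : nat) : seq (int_hyperplane m) :=
  [seq coord_hyp s b | s <- enum 'I_m, b <- [:: 0; 1]] ++
  flatten [seq [:: sum_hyp p.1 p.2 0; sum_hyp p.1 p.2 1;
                   diff_hyp p.1 p.2 0; diff_hyp p.1 p.2 1]
          | p <- enum [pred p : 'I_m * 'I_m | (p.1 < p.2)%N]].

(* |M((A^H)_q)| *)
Definition restr_compl_card (q m : nat) (A : seq (int_hyperplane m))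
    (H : int_hyperplane m) : nat :=
  #|[set x : 'rV['Z_q]_m in hyperplane_mod q H |
      all (fun H' => x \notin hyperplane_mod q H') [seq H' <- A | H' != H]]|.

Definition quasi_polynomial (f : nat -> int) : Prop :=
  exists (rho : nat) (g : nat -> {poly int}),
    (0 < rho)%N /\
    forall q : nat, (0 < q)%N -> f q = (g (q %% rho)%N).[q%:Z].

(* Such an f is unique on positive integers, since each constituent g r is
   determined by its values at infinitely many q. *)
Definition restr_char_quasi_polynomial (m : nat) (A : seq (int_hyperplane m))
    (H : int_hyperplane m) (f : nat -> int) : Prop :=
  quasi_polynomial f /\
  exists q0 : nat, forall q : nat, (1 < q)%N -> (q0 <= q)%N ->
    (restr_compl_card q A H)%:Z = f q.

(* Main.v *)
Require Import Defs.
From mathcomp Require Import all_boot all_order all_algebra.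
From mathcomp Require Import zify.

(* Fold Z_q onto the half circle 0, ..., q/2: a point x becomes a placement of
   signed labels, with +s at position p if x_s = p and -s if x_s = -p, the
   equation x_i = 0 being read as -i at position 0.  The point avoids the
   arrangement iff the positions are distinct and labels on adjacent positions
   increase in the order +1 < ... < +m < -m < ... < -1 (when q is even, the two
   signs agree at q/2 and + is the convention compatible with this order).
   Such a placement is a sequence of sorted blocks separated by empty positions,
   so it amounts to an independent choice, for every label s <> i, of a sign and
   of one of the q/2 - m + 2 gaps between empty positions.  The sorted block at
   position 0 starts with -i, so its other labels are -s with s < i; the last gap
   admits only positive labels when q is even.  This leaves q - 2m + 2 choices
   for s < i and q - 2m + 1 choices for s > i, whatever the parity of q. *)

Set Implicit Arguments.
Unset Strict Implicit.
Unset Printing Implicit Defensive.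

Import GRing.Theory.
Local Open Scope ring_scope.

(** * Placements with empty positions: [fill] and [gap] are mutually inverse *)

Definition key_lt (T : finType) (e r : T -> nat) (s t : T) : bool :=
  ((e s < e t) || ((e s == e t) && (r s < r t)))%N.

(* [r] is the rank of a label inside its block and [e s] the number of empty
   positions before [s]. *)
Definition fill (T : finType) (e r : T -> nat) (s : T) : nat :=
  (e s + #|[set t | key_lt e r t s]|)%N.

(** Number of empty positions below [p s]. For injective [p] the subtraction does not truncate, as
    at most [p s] labels lie below. *)
Definition gap (T : finType) (p : T -> nat) (s : T) : nat :=
  (p s - #|[set t | (p t < p s)%N]|)%N.

(** Everything that precedes [s], and [s] itself, precedes [t]; this gains at least one position on
    top of the [e t - e s] empty ones. *)
Lemma fill_lt (T : finType) (e r : T -> nat) (s t : T) :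
  key_lt e r s t -> (fill e r s + (e t - e s) < fill e r t)%N.
Proof.
move=> st; rewrite /fill.
suff: (#|[set u | key_lt e r u s]| < #|[set u | key_lt e r u t]|)%N.
  by move: st; rewrite /key_lt; lia.
apply: proper_card; apply/properP; split.
  by apply/subsetP=> u; rewrite !inE; move: st; rewrite /key_lt; lia.
by exists s; rewrite !inE // /key_lt; lia.
Qed.

Lemma fill_ltE (T : finType) (e r : T -> nat) (s t : T) : injective r ->
  (fill e r s < fill e r t)%N = key_lt e r s t.
Proof.
move=> rI; apply/idP/idP=> [st|/fill_lt]; last by lia.
have [|nst] := boolP (key_lt e r s t) => //.
have [ts|nts] := boolP (key_lt e r t s).
  by have := fill_lt ts; lia.
have ets : s = t by apply: (rI); move: nst nts; rewrite /key_lt; lia.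
by move: st; rewrite ets ltnn.
Qed.

Lemma fill_inj (T : finType) (e r : T -> nat) :
  injective r -> injective (fill e r).
Proof.
move=> rI s t st; apply: (rI).
have := fill_ltE e s t rI; have := fill_ltE e t s rI.
by rewrite st /key_lt; lia.
Qed.

(** No empty position fits between adjacent ones, so [e s = e t] and the rank decides. *)
Lemma fill_adjacent (T : finType) (e r : T -> nat) (s t : T) : injective r ->
  fill e r t = (fill e r s).+1 -> (r s < r t)%N.
Proof.
move=> rI st.
have kst : key_lt e r s t by rewrite -(fill_ltE e s t rI); lia.
by have := fill_lt kst; move: kst; rewrite /key_lt; lia.
Qed.

Lemma fill_le (T : finType) (e r : T -> nat) (s : T) :
  (fill e r s < e s + #|T|)%N.
Proof.
rewrite ltn_add2l -cardsT; apply: proper_card; apply/properP; split.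
  exact: subsetT.
by exists s; rewrite !inE // /key_lt; lia.
Qed.

Lemma gap_fill (T : finType) (e r : T -> nat) (s : T) : injective r ->
  gap (fill e r) s = e s.
Proof.
move=> rI; rewrite /gap.
under eq_finset => t do rewrite (fill_ltE e t s rI).
by rewrite /fill addnK.
Qed.

Lemma card_preim_range (T : finType) (p : T -> nat) (a c : nat) :
  injective p -> (#|[set t | (a <= p t < c)%N]| <= c - a)%N.
Proof.
move=> pI; rewrite cardE -(size_map p) -(size_iota a (c - a)).
apply: uniq_leq_size; first by rewrite map_inj_uniq // enum_uniq.
by move=> n /mapP[t]; rewrite mem_enum inE mem_iota => ? ->; lia.
Qed.

Lemma card_below_range (T : finType) (p : T -> nat) (a c : nat) : (a <= c)%N ->
  #|[set t | (p t < c)%N]| =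
    (#|[set t | (p t < a)%N]| + #|[set t | (a <= p t < c)%N]|)%N.
Proof.
move=> ac; rewrite -(cardsID [set t | (p t < a)%N]).
by congr addn; apply: eq_card => t; rewrite !inE; lia.
Qed.

Lemma card_below (T : finType) (p : T -> nat) (c : nat) :
  injective p -> (#|[set t | (p t < c)%N]| <= c)%N.
Proof. by move=> /(card_preim_range 0 c); rewrite subn0. Qed.

(** The labels not below [s] fit into the [c - p s] positions from [p s] on. *)
Lemma gap_add_card (T : finType) (p : T -> nat) (c : nat) (s : T) :
  injective p -> (forall t, p t < c)%N -> (gap p s + #|T| <= c)%N.
Proof.
move=> pI pc; have := card_below_range p (ltnW (pc s)).
have -> : #|[set t | (p t < c)%N]| = #|T|.
  by rewrite -cardsT; apply: eq_card => t; rewrite !inE pc.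
have := card_preim_range (p s) c pI; have := card_below (p s) pI.
by rewrite /gap; have := pc s; lia.
Qed.

(** Strong induction on [p t]. If some [u] sits just before [t], both have the same gap and the rank
    increases from [u] to [t]; otherwise that position is empty and the gap strictly increases from
    [s] to [t]. *)
Lemma key_lt_gap (T : finType) (p r : T -> nat) (s t : T) :
  injective p -> (forall u v, p v = (p u).+1 -> (r u < r v)%N) ->
  (p s < p t)%N -> key_lt (gap p) r s t.
Proof.
move=> pI adj; have [n] := ubnP (p t); elim: n t => // n IHn t pn pst.
have ps := card_below (p s) pI; have ct := card_below (p t) pI.
have [u /eqP pu | nou] := pickP [pred u | (p u).+1 == p t].
  have : key_lt (gap p) r u t.
    have := @card_below_range _ p (p u) (p t); rewrite -pu => /(_ (leqnSn _)).
    have := card_preim_range (p u) (p u).+1 pI; have := card_below (p u) pI.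
    by have := adj u t; rewrite -pu /key_lt /gap -pu => /(_ erefl); lia.
  have [su|us] := ltnP (p s) (p u); last by rewrite (pI u s) //; lia.
  by have := IHn u; rewrite su -ltnS pu => /(_ pn isT); rewrite /key_lt; lia.
have := @card_below_range _ p (p s) (p t) (ltnW pst).
have -> : #|[set v | (p s <= p v < p t)%N]| =
    #|[set v | (p s <= p v < (p t).-1)%N]|.
  by apply: eq_card => v; rewrite !inE; have := nou v => /=; lia.
have sn : (p s < (p t).-1)%N by have := nou s => /=; lia.
by have := card_preim_range (p s) (p t).-1 pI; rewrite /key_lt /gap; lia.
Qed.

Lemma fill_gap (T : finType) (p r : T -> nat) (s : T) :
  injective p -> (forall u v, p v = (p u).+1 -> (r u < r v)%N) ->
  fill (gap p) r s = p s.
Proof.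
move=> pI adj; rewrite /fill.
have -> : [set t | key_lt (gap p) r t s] = [set t | (p t < p s)%N].
  apply/setP=> t; rewrite !inE; apply/idP/idP => [ts|]; last exact: key_lt_gap.
  have [|st|st] := ltngtP (p t) (p s) => //.
    by have := key_lt_gap pI adj st; move: ts; rewrite /key_lt; lia.
  by move: ts; rewrite (pI _ _ st) /key_lt; lia.
by rewrite /gap subnK // card_below.
Qed.

(** * Folding residues modulo [q] onto signed positions *)

Lemma intr_Zp_eq0 (q : nat) (w : int) : (1 < q)%N -> (`|w| < 2 * q)%N ->
  (w%:~R == 0 :> 'Z_q) = [|| w == 0, w == q%:Z | w == - q%:Z].
Proof.
move=> q1 wq.
have -> : (w%:~R == 0 :> 'Z_q) = (`|w|%N%:R == 0 :> 'Z_q).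
  by case: (intP w) => // n; rewrite mulrNz oppr_eq0 abszN.
rewrite -val_eqE /= val_Zp_nat //.
have [wq1|qw] := ltnP `|w|%N q; first by rewrite modn_small; lia.
by rewrite -(subnK qw) modnDr modn_small; lia.
Qed.

(** Labels are zero-based: positive ones take the values 0 to [m - 1], negative ones [m + 1] to
    [2m], in reversed order. *)
Definition signed_rank (m : nat) (b : bool) (s : nat) : nat :=
  if b then (2 * m - s)%N else s.

Definition signed_pos (b : bool) (p : nat) : int :=
  if b then - p%:Z else p%:Z.

(* Makes the sign unique at the two fixed points of negation: - at 0, + at q/2. *)
Definition normal_pos (q : nat) (b : bool) (p : nat) : bool :=
  [&& 2 * p <= q, (p == 0) ==> b & (2 * p == q) ==> ~~ b]%N.

Lemma signed_pos_inj (q p p' : nat) (b b' : bool) : (2 < q)%N ->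
  normal_pos q b p -> normal_pos q b' p' ->
  (signed_pos b p)%:~R = (signed_pos b' p')%:~R :> 'Z_q -> (b, p) = (b', p').
Proof.
move=> q2 np np' /eqP; rewrite -subr_eq0 -mulrzBr intr_Zp_eq0; try lia.
  by rewrite /signed_pos => h; congr pair; move: h np np';
    rewrite /normal_pos; case: b; case: b'; lia.
by move: np np'; rewrite /normal_pos /signed_pos; case: b; case: b'; lia.
Qed.

Lemma signed_pos_surj (q : nat) (x : 'Z_q) : (1 < q)%N ->
  exists bp, normal_pos q bp.1 bp.2 /\ x = (signed_pos bp.1 bp.2)%:~R.
Proof.
move=> q1; have xq : (x < q)%N by rewrite -[X in (_ < X)%N](Zp_cast q1).
have [xs|xl] := boolP ((0 < x) && (2 * x <= q))%N.
  exists (false, (x : nat)); split; first by rewrite /normal_pos /=; lia.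
  by rewrite /= -pmulrn natr_Zp.
(* The remainder sends [x = 0] to position 0 instead of [q]. *)
exists (true, ((q - x) %% q)%N); split => /=.
  have [x0|x0] := posnP x; first by rewrite x0 subn0 modnn /normal_pos /=; lia.
  by rewrite modn_small /normal_pos /=; lia.
apply/eqP; rewrite mulrNz -pmulrn -addr_eq0 -{1}[x]natr_Zp -natrD.
by rewrite -val_eqE /= val_Zp_nat // modnDmr subnKC ?modnn // ltnW.
Qed.

(** All expressions lift to integers below [2q] in absolute value. The value 0 means equal
    positions. For adjacent positions the value 1 depends on the sign of [s] only: it occurs if [s]
    is the lower label and negative, or the upper one and positive. As [s < t], these are the
    violations of the rank order. *)
Lemma shi_pair_conditions (q m s t p p' : nat) (b b' : bool)
    (z := signed_pos b p) (z' := signed_pos b' p') :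
  (2 < q)%N -> (s < t < m)%N -> normal_pos q b p -> normal_pos q b' p' ->
  [&& z%:~R + z'%:~R != 0 :> 'Z_q, z%:~R + z'%:~R != 1 :> 'Z_q,
      z%:~R - z'%:~R != 0 :> 'Z_q & z%:~R - z'%:~R != 1 :> 'Z_q] =
  [&& p != p', (p' == p.+1) ==> (signed_rank m b s < signed_rank m b' t)%N
    & (p == p'.+1) ==> (signed_rank m b' t < signed_rank m b s)%N].
Proof.
move=> q2 st np np'.
rewrite -!mulrzDr -!mulrzBr -!(subr_eq0 _ 1) -[1]/(1%:~R) -!mulrzBr.
by rewrite !intr_Zp_eq0 {}/z {}/z'; move: np np';
  rewrite /normal_pos /signed_pos /signed_rank; case: b; case: b'; lia.
Qed.

(** * Explicit conditions for the complement of the restriction *)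

Lemma in_hyperplane_mod (q m : nat) (H : int_hyperplane m) (x : 'rV['Z_q]_m) :
  (x \in hyperplane_mod q H) = (\sum_j (H.1 0 j)%:~R * x 0 j == H.2%:~R).
Proof. by rewrite inE. Qed.

Lemma sum_delta (q m : nat) (s : 'I_m) (x : 'rV['Z_q]_m) :
  \sum_j ((delta_mx 0 s : 'rV[int]_m) 0 j)%:~R * x 0 j = x 0 s.
Proof.
rewrite (bigD1 s) //= big1 ?addr0 => [|j js]; first by rewrite mxE !eqxx mul1r.
by rewrite mxE (negPf js) mul0r.
Qed.

Lemma in_coord_hyp (q m : nat) (s : 'I_m) (b : int) (x : 'rV['Z_q]_m) :
  (x \in hyperplane_mod q (coord_hyp s b)) = (x 0 s == b%:~R).
Proof. by rewrite in_hyperplane_mod sum_delta. Qed.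

Lemma in_sum_hyp (q m : nat) (s t : 'I_m) (b : int) (x : 'rV['Z_q]_m) :
  (x \in hyperplane_mod q (sum_hyp s t b)) = (x 0 s + x 0 t == b%:~R).
Proof.
rewrite in_hyperplane_mod -(sum_delta s) -(sum_delta t) -big_split /=.
by congr (_ == _); apply: eq_bigr => j _; rewrite mxE mulrzDr mulrDl.
Qed.

Lemma in_diff_hyp (q m : nat) (s t : 'I_m) (b : int) (x : 'rV['Z_q]_m) :
  (x \in hyperplane_mod q (diff_hyp s t b)) = (x 0 s - x 0 t == b%:~R).
Proof.
rewrite in_hyperplane_mod -(sum_delta s) -(sum_delta t) -sumrB /=.
by congr (_ == _); apply: eq_bigr => j _; rewrite !mxE mulrzBr mulrBl.
Qed.

Lemma coord_hyp_eq (m : nat) (s i : 'I_m) (b c : int) :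
  (coord_hyp s b == coord_hyp i c) = (s == i) && (b == c).
Proof.
rewrite xpair_eqE; congr (_ && _); apply/eqP/eqP => [|-> //].
by move=> /rowP/(_ s); rewrite !mxE !eqxx /=; case: eqP.
Qed.

(** Two coefficients are nonzero here, only one in a coordinate equation; so this equation survives
    the removal of [x_i = 0]. *)
Lemma sum_hyp_neq_coord (m : nat) (s t i : 'I_m) (b c : int) :
  s != t -> sum_hyp s t b != coord_hyp i c.
Proof.
move=> st; rewrite xpair_eqE negb_and; apply/orP; left.
apply/eqP=> /rowP e; have := e s; have := e t; rewrite !mxE !eqxx /=.
rewrite ?(eq_sym t s) (negPf st) /=.
case: (eqVneq t i) => // ti _; case: eqVneq => // si.
by rewrite ti si eqxx in st.
Qed.

Lemma diff_hyp_neq_coord (m : nat) (s t i : 'I_m) (b c : int) :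
  s != t -> diff_hyp s t b != coord_hyp i c.
Proof.
move=> st; rewrite xpair_eqE negb_and; apply/orP; left.
apply/eqP=> /rowP e; have := e t; rewrite !mxE !eqxx /=.
by rewrite (eq_sym t s) (negPf st) /=; case: eqVneq.
Qed.

Lemma shiB_restr_complP (q m : nat) (i : 'I_m) (x : 'rV['Z_q]_m) : (1 < q)%N ->
  reflect
    [/\ x 0 i = 0, forall s, (s != i -> x 0 s != 0) /\ x 0 s != 1 &
        forall s t : 'I_m, (s < t)%N ->
          [&& x 0 s + x 0 t != 0, x 0 s + x 0 t != 1,
              x 0 s - x 0 t != 0 & x 0 s - x 0 t != 1]]
    (x \in [set x : 'rV['Z_q]_m in hyperplane_mod q (coord_hyp i 0) |
      all (fun H' => x \notin hyperplane_mod q H')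
          [seq H' <- shiB m | H' != coord_hyp i 0]]).
Proof.
move=> q1; rewrite inE in_coord_hyp; apply: (iffP andP).
  case=> /eqP xi; rewrite all_filter all_cat => /andP[/allP c /allP d]; split=> //.
    move=> s; split=> [si|].
      have /c/implyP : coord_hyp s 0 \in [seq coord_hyp s b | s <- enum 'I_m, b <- [:: 0; 1]].
        by apply: allpairs_f; rewrite ?mem_enum ?inE.
      by rewrite in_coord_hyp coord_hyp_eq (negPf si); apply.
    have /c/implyP : coord_hyp s 1 \in [seq coord_hyp s b | s <- enum 'I_m, b <- [:: 0; 1]].
      by apply: allpairs_f; rewrite ?mem_enum ?inE.
    by rewrite in_coord_hyp coord_hyp_eq andbF; apply.
  move=> s t st.
  have nst : s != t by rewrite -val_eqE /=; lia.
  have {}d H : H \in [:: sum_hyp s t 0; sum_hyp s t 1; diff_hyp s t 0; diff_hyp s t 1] ->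
      (H != coord_hyp i 0) ==> (x \notin hyperplane_mod q H).
    by move=> hH; apply: d; apply/flatten_mapP; exists (s, t); rewrite // mem_enum inE.
  have := d (sum_hyp s t 0); have := d (sum_hyp s t 1).
  have := d (diff_hyp s t 0); have := d (diff_hyp s t 1).
  rewrite !in_cons !eqxx !orbT !sum_hyp_neq_coord // !diff_hyp_neq_coord //.
  rewrite !in_sum_hyp !in_diff_hyp /=.
  by move=> /(_ isT) -> /(_ isT) -> /(_ isT) -> /(_ isT) ->.
case=> xi c d; rewrite xi; split=> //; rewrite all_filter all_cat.
apply/andP; split; apply/allP=> H.
  case/allpairsP=> -[s b] [/= _]; rewrite !in_cons in_nil orbF => /orP[] /eqP -> ->;
  rewrite in_coord_hyp coord_hyp_eq ?andbF ?andbT; apply/implyP => si; by apply (c s).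
case/flatten_mapP=> -[s t]; rewrite mem_enum inE /= => /d /and4P[d1 d2 d3 d4].
by rewrite !in_cons in_nil orbF => /or4P[] /eqP ->; rewrite ?in_sum_hyp ?in_diff_hyp; apply/implyP.
Qed.

(** * Counting the choices for a single label *)

Definition allowed (q k m : nat) (i s : 'I_m) (b : bool) (e : nat) : bool :=
  if s == i then b && (e == 0%N) else
  ((e == 0%N) ==> b && (s < i)%N) && ((e == k.+1) && ~~ odd q ==> ~~ b).

(** The [k + m + 1] positions from 0 to [q./2] carry [m] labels, hence [k + 1] are empty and there
    are [2 (k + 2)] pairs of a sign and a gap. For [s <> i], gap 0 excludes one pair if [s < i] and
    two if [s > i]. The last gap excludes one more for even [q], which offsets the rounding in
    [q./2]. *)
Lemma card_allowed (q k m : nat) (i s : 'I_m) : q./2 = (k + m)%N ->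
  #|[pred be : bool * 'I_k.+2 | allowed q k i s be.1 be.2]|%:Z =
    if s == i then 1 else
    if (s < i)%N then q%:Z - (2 * m)%:Z + 2 else q%:Z - (2 * m)%:Z + 1.
Proof.
move=> qk; have := odd_double_half q; rewrite qk -muln2 => qE.
have -> : #|[pred be : bool * 'I_k.+2 | allowed q k i s be.1 be.2]| =
    (\sum_(b : bool) \sum_(e < k.+2) allowed q k i s b e)%N.
  rewrite pair_bigA -sum1_card big_mkcond; apply: eq_bigr => -[b e] _.
  by rewrite inE; case: ifP.
(* Gaps 0 and [k + 1] are split off; the [k] inner gaps allow both signs when [s <> i]. *)
rewrite big_bool /= !(@big_ord_recl _ _ _ k.+1) !(@big_ord_recr _ _ _ k) /allowed /=.
under eq_bigr => j _.
  rewrite /bump /= (_ : (_ == k.+1) = false); last by have := ltn_ord j; lia.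
  over.
under [X in (_ + (_ + (X + _)))%N]eq_bigr => j _.
  rewrite /bump /= (_ : (_ == k.+1) = false); last by have := ltn_ord j; lia.
  over.
rewrite /= !big_const_ord (_ : bump 0 k = k.+1) // eqxx /=.
case: eqP => _ /=.
  by rewrite !iter_addn; lia.
by rewrite !iter_addn; case: (odd q) qE => qE; case: (s < i)%N => /=; lia.
Qed.

(** * Packed placements and allowed choices determine each other *)

Lemma signed_rank_inj (m : nat) (b : 'I_m -> bool) :
  injective (fun s => signed_rank m (b s) s).
Proof.
by move=> s t; rewrite /signed_rank => e; apply: val_inj => /=;
  have := ltn_ord s; have := ltn_ord t; move: e; case: (b s); case: (b t); lia.
Qed.

Definition packed (q m : nat) (i : 'I_m) (b : 'I_m -> bool) (p : 'I_m -> nat) :=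
  [/\ injective p, p i = 0%N, forall s, normal_pos q (b s) (p s) &
      forall s t : 'I_m, p t = (p s).+1 ->
        (signed_rank m (b s) s < signed_rank m (b t) t)%N].

Lemma packed_fill (q k m : nat) (i : 'I_m) (b : 'I_m -> bool) (e : 'I_m -> nat) :
  q./2 = (k + m)%N -> (forall s, e s < k.+2)%N ->
  (forall s, allowed q k i s (b s) (e s)) ->
  packed q i b (fill e (fun s => signed_rank m (b s) s)).
Proof.
move=> qk ek ok; have := odd_double_half q; rewrite qk -muln2 => qE.
have rI := @signed_rank_inj m b.
have /andP[bi /eqP ei] : b i && (e i == 0%N) by have := ok i; rewrite /allowed eqxx.
have pi : fill e (fun s => signed_rank m (b s) s) i = 0%N.
  (* Nothing precedes [i]: the other labels in gap 0 are negative and smaller than [i], so their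
     rank is larger. *)
  rewrite /fill ei; apply/eqP; rewrite cards_eq0; apply/eqP/setP=> t.
  rewrite !inE /key_lt ei bi /=; apply/negbTE; rewrite andbC.
  have := ok t; rewrite /allowed; case: (eqVneq t i) => [->|_].
    by rewrite bi ltnn.
  rewrite /signed_rank; case: (b t); have := ltn_ord i; lia.
split=> //; first exact: fill_inj.
  move=> s; have := fill_le e (fun s => signed_rank m (b s) s) s.
  rewrite card_ord => le; rewrite /normal_pos.
  have := ok s; rewrite /allowed; have [->|si] := eqVneq s i.
    by rewrite pi; have := ltn_ord i; lia.
  move=> oks; apply/and3P; split.
  - by have := ek s; lia.
  - by apply/implyP; rewrite /fill addn_eq0 => /andP[es _]; move: oks; rewrite es; lia.
  (* Fewer than [m] labels precede [s], so position [q/2 = k + m] forces the last gap, which is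
     positive for even [q]. *)
  - apply/implyP => /eqP ps; have -> : ~~ b s = true; last by [].
    by have := ek s; move: oks; lia.
by move=> s t; apply: fill_adjacent.
Qed.

Lemma allowed_gap (q k m : nat) (i : 'I_m) (b : 'I_m -> bool) (p : 'I_m -> nat) :
  q./2 = (k + m)%N -> packed q i b p ->
  (forall s, gap p s < k.+2)%N /\ (forall s, allowed q k i s (b s) (gap p s)).
Proof.
move=> qk [pI pi np adj]; have := odd_double_half q; rewrite qk -muln2 => qE.
have pq t : (p t < (k + m).+1)%N by have := np t; rewrite /normal_pos; lia.
have gapk s : (gap p s < k.+2)%N by have := gap_add_card s pI pq; rewrite card_ord; lia.
split=> // s.
have bi : b i by have := np i; rewrite /normal_pos pi; lia.
have gi : gap p i = 0%N by rewrite /gap pi.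
rewrite /allowed; have [->|si] := eqVneq s i; first by rewrite bi gi.
apply/andP; split; apply/implyP.
  (* In gap 0 the label [s] must outrank the negative label [i], so it is negative with [s < i]. *)
  move=> /eqP gs; have pis : (p i < p s)%N.
    by rewrite pi lt0n -pi (inj_eq pI).
  have := key_lt_gap pI adj pis; rewrite /key_lt gi gs bi /= /signed_rank.
  by have := ltn_ord s; have := ltn_ord i; case: (b s); lia.
move=> /andP[/eqP gs qeven].
(* If position [q/2] were free, every gap would be at most [k]. So it holds some [u], which is
   positive by normalization; [s] is [u] or ranks below it in the same gap, hence is positive
   too. *)
have [u /eqP pu | nou] := pickP [pred u | p u == (k + m)%N]; last first.
  have pq' t : (p t < k + m)%N by have := nou t; have := pq t => /=; lia.
  by have := gap_add_card s pI pq'; rewrite card_ord; lia.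
have bu : ~~ b u by have := np u; rewrite /normal_pos pu; lia.
have [su|us] := ltnP (p s) (p u); last by rewrite (pI s u) //; have := pq s; lia.
have := key_lt_gap pI adj su; have := gapk u.
rewrite /key_lt gs (negPf bu) /signed_rank.
by have := ltn_ord s; have := ltn_ord u; case: (b s); lia.
Qed.

(** * Points of the complement as packed placements *)

Lemma shiB_restr_compl_packed (q m : nat) (i : 'I_m)
    (b : 'I_m -> bool) (p : 'I_m -> nat) :
  (2 < q)%N -> (forall s, normal_pos q (b s) (p s)) ->
  (\row_s (signed_pos (b s) (p s))%:~R
    \in [set x : 'rV['Z_q]_m in hyperplane_mod q (coord_hyp i 0) |
      all (fun H' => x \notin hyperplane_mod q H')
          [seq H' <- shiB m | H' != coord_hyp i 0]]) <-> packed q i b p.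
Proof.
move=> q2 np.
have pair (s t : 'I_m) (st : (s < t)%N) :=
  @shi_pair_conditions q m s t _ _ _ _ q2 (introT andP (conj st (ltn_ord t)))
    (np s) (np t).
have b0 s : p s = 0%N -> b s by have := np s; rewrite /normal_pos; lia.
have z_eq s (c : int) : (`|c| < 2)%N ->
    ((signed_pos (b s) (p s))%:~R == c%:~R :> 'Z_q) = (signed_pos (b s) (p s) == c).
  move=> c2; rewrite -subr_eq0 -mulrzBr; have := np s.
  by rewrite /normal_pos => h; rewrite intr_Zp_eq0; move: h; rewrite /signed_pos;
    case: (b s); lia.
split=> [/(shiB_restr_complP _ _ (ltnW q2))[]|[pI pi _ adj]].
  rewrite !mxE => /eqP; rewrite (z_eq i 0) // => pi0 c d.
  have pi : p i = 0%N by move: pi0; rewrite /signed_pos; case: (b i); lia.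
  have key (s t : 'I_m) : (s < t)%N ->
      [&& p s != p t,
          (p t == (p s).+1) ==> (signed_rank m (b s) s < signed_rank m (b t) t)%N
        & (p s == (p t).+1) ==> (signed_rank m (b t) t < signed_rank m (b s) s)%N].
    move=> st; rewrite -(pair s t) //.
    by have := d s t st; rewrite !mxE.
  split=> //.
    move=> s t e; apply: val_inj => /=.
    by have [/key|/key|//] := ltngtP s t; rewrite e eqxx.
  move=> s t e; have [/key|/key|/val_inj est] := ltngtP s t.
  - by rewrite e eqxx => /and3P[].
  - by rewrite e eqxx => /and3P[].
  - by move: e; rewrite est; lia.
apply/(shiB_restr_complP _ _ (ltnW q2)).
have bi := b0 i pi.
split; first by rewrite mxE pi /signed_pos; case: (b i).
  move=> s; rewrite mxE (z_eq s 0) // (z_eq s 1) //; split.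
    move=> si; have : p s != p i by rewrite (inj_eq pI).
    by rewrite pi /signed_pos; case: (b s); lia.
  rewrite /signed_pos; case bs: (b s); first by lia.
  (* [x_s = 1] would put a positive label at position 1, next to the negative [i] at 0, against the
     rank order. *)
  apply/eqP => -[ps]; have := adj i s; rewrite pi ps => /(_ erefl).
  by rewrite bi bs /signed_rank; have := ltn_ord i; have := ltn_ord s; lia.
move=> s t st; rewrite !mxE (pair s t) //; apply/and3P; split.
- by rewrite (inj_eq pI) -val_eqE /=; lia.
- by apply/implyP => /eqP/adj.
- by apply/implyP => /eqP/adj.
Qed.

(** Filling the gaps is a bijection from independent allowed choices onto the complement. *)
Lemma card_shiB_restr_compl (q k m : nat) (i : 'I_m) :
  (2 < q)%N -> q./2 = (k + m)%N ->
  restr_compl_card q (shiB m) (coord_hyp i 0) =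
  (\prod_s #|[pred be : bool * 'I_k.+2 | allowed q k i s be.1 be.2]|)%N.
Proof.
move=> q2 qk.
pose F := family (fun s : 'I_m =>
  [pred be : bool * 'I_k.+2 | allowed q k i s be.1 be.2]).
transitivity #|F|; last by rewrite card_family foldrE big_image.
rewrite /restr_compl_card.
pose b (o : {ffun 'I_m -> bool * 'I_k.+2}) s := (o s).1.
pose e (o : {ffun 'I_m -> bool * 'I_k.+2}) s : nat := (o s).2.
pose r o s := signed_rank m (b o s) s.
have Fok o s : o \in F -> allowed q k i s (b o s) (e o s).
  by move=> /familyP/(_ s); rewrite inE.
have ek o s : (e o s < k.+2)%N by apply: ltn_ord.
have pack o : o \in F -> packed q i (b o) (fill (e o) (r o)).
  by move=> oF; apply: (packed_fill qk) => // s; apply: Fok.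
pose f o : 'rV['Z_q]_m := \row_s (signed_pos (b o s) (fill (e o) (r o) s))%:~R.
(* A point determines signs and positions, and the positions determine the gaps. *)
have fI : {in F &, injective f}.
  move=> o o' oF oF' /rowP ff.
  have bp s : (b o s, fill (e o) (r o) s) = (b o' s, fill (e o') (r o') s).
    case: (pack o oF) (pack o' oF') => _ _ np _ [_ _ np' _].
    by apply: (signed_pos_inj q2 (np s) (np' s)); have := ff s; rewrite !mxE.
  apply/ffunP=> s; rewrite [o s]surjective_pairing [o' s]surjective_pairing.
  congr pair; first by case: (bp s).
  apply: val_inj; change (e o s = e o' s).
  rewrite -(gap_fill (e o) s (@signed_rank_inj m (b o))).
  rewrite -(gap_fill (e o') s (@signed_rank_inj m (b o'))) /gap.
  have pE t : fill (e o) (r o) t = fill (e o') (r o') t by case: (bp t).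
  rewrite -!/(r _) -!/(r o) -!/(r o') pE; congr subn; apply: eq_card => t.
  by rewrite !inE !pE.
rewrite -(card_in_imset fI); apply: eq_card => x; apply/idP/imsetP; last first.
  case=> o oF ->; apply/shiB_restr_compl_packed => //; last exact: pack.
  by case: (pack o oF).
move=> xX.
have /fin_all_exists[bp bpP] s := signed_pos_surj (x 0 s) (ltnW q2).
have xE : x = \row_s (signed_pos (bp s).1 (bp s).2)%:~R.
  by apply/rowP=> s; rewrite mxE; case: (bpP s).
have np s : normal_pos q (bp s).1 (bp s).2 by case: (bpP s).
move: xX; rewrite xE => /(shiB_restr_compl_packed i q2 np) pk.
have [gk gok] := allowed_gap qk pk; case: (pk) => pI _ _ adj.
exists [ffun s => ((bp s).1, Ordinal (gk s))].
  by apply/familyP=> s; rewrite inE ffunE /=.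
apply/rowP=> s; rewrite !mxE /f /b /e /r ffunE /=.
rewrite -(fill_gap s pI adj) /fill /key_lt.
congr (signed_pos _ (addn _ _))%:~R; first by rewrite ffunE.
by apply: eq_card => t; rewrite !inE /b !ffunE.
Qed.

(** * Evaluating the product over all labels *)

Lemma card_ord_lt (m : nat) (i : 'I_m) : #|[pred s : 'I_m | (s < i)%N]| = i.
Proof.
rewrite -sum1_card (big_ord_narrow (ltnW (ltn_ord i))) /=.
by rewrite sum1_card card_ord.
Qed.

Lemma card_ord_gt (m : nat) (i : 'I_m) :
  #|[pred s : 'I_m | (i < s)%N]| = (m - i.+1)%N.
Proof.
have := cardC [pred s : 'I_m | (s < i)%N]; rewrite card_ord_lt card_ord.
rewrite (cardD1 i) !inE ltnn add1n addnS -addSn => im.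
rewrite -[X in (X - _)%N]im addKn; apply: eq_card => s.
by rewrite !inE -val_eqE /=; lia.
Qed.

(* i : 'I_m is the zero-based index: it stands for the index i + 1 of [m]. *)
Theorem theorem3p1 (m : nat) (hm : (1 <= m)%N) (i : 'I_m) :
  (exists q0 : nat, forall q : nat, (1 < q)%N -> (q0 <= q)%N ->
    (restr_compl_card q (shiB m) (coord_hyp i 0))%:Z =
      (q%:Z - (2 * m)%:Z + 1) ^+ (m - i.+1) *
      (q%:Z - (2 * m)%:Z + 2) ^+ i) /\
  restr_char_quasi_polynomial (shiB m) (coord_hyp i 0)
    (fun q : nat => (q%:Z - (2 * m)%:Z + 1) ^+ (m - i.+1) *
                    (q%:Z - (2 * m)%:Z + 2) ^+ i).
Proof.
set count := (X in X /\ _).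
suff h : count.
  (* One polynomial serves both parities, so the period is 1. *)
  split=> //; split=> //; exists 1%N.
  exists (fun _ => ('X - (2 * m)%:Z%:P + 1) ^+ (m - i.+1) *
                   ('X - (2 * m)%:Z%:P + 2%:P) ^+ i).
  by split=> // q _; rewrite !hornerE.
(* The bound ensures [m <= q./2], so that [k = q./2 - m] is not truncated, and [2 < q]. *)
exists (2 * m + 3)%N => q _ qm.
have qk : q./2 = (q./2 - m + m)%N by lia.
rewrite (card_shiB_restr_compl i _ qk); last by lia.
rewrite (big_morph Posz PoszM (erefl 1%:Z)).
rewrite (eq_bigr _ (fun s _ => card_allowed i s qk)).
set A := _ + 1; set B := _ + 2.
rewrite (bigD1 i) //= eqxx mul1r.
rewrite (bigID (fun s : 'I_m => (s < i)%N)) /= mulrC; congr (_ * _).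
  rewrite (eq_bigr (fun _ => A)); last first.
    by move=> s /andP[/negPf -> /negPf ->].
  rewrite prodr_const; congr (_ ^+ _).
  rewrite -(card_ord_gt i); apply: eq_card => s.
  by rewrite inE unfold_in -val_eqE /=; lia.
rewrite (eq_bigr (fun _ => B)); last by move=> s /andP[/negPf -> ->].
rewrite prodr_const; congr (_ ^+ _).
rewrite -[RHS](card_ord_lt i); apply: eq_card => s.
by rewrite inE unfold_in -val_eqE /=; lia.
Qed.
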